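(* Let $\boldsymbol{o}=(o_n)_{n\ge 0}$ be the increasing sequence with $\{o_n \mid n\in\mathbb{N}\}=\{m\in\mathbb{N}\mid d_m=1\}$, where $\boldsymbol{d}=(d_n)_{n\ge 0}$ is the period-doubling sequence. Then $\boldsymbol{o}$ is not $k$-regular for any integer $k\ge 2$.
   Context: $\mathbb{N}=\{0,1,2,\ldots\}$. The period-doubling sequence $\boldsymbol{d}=(d_n)_{n\ge 0}$ is defined by $d_n=\nu_2(n+1) \bmod 2\in\{0,1\}$, where $\nu_2(m)$ is the exponent of the highest power of $2$ dividing $m$. For an integer $k\ge 2$, the $k$-kernel of a sequence $(s_n)_{n\ge 0}$ is the set of subsequences $\{(s_{k^i n+r})_{n\ge 0}\mid i\ge 0,\ 0\le r<k^i\}$. An integer sequence is $k$-regular if there exists a finite set $S$ of (integer) sequences such that every sequence in its $k$-kernel is a $\mathbb{Z}$-linear combination of sequences of $S$. *)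

(* Defs.v *)
From HB Require Import structures.
From mathcomp Require Import all_boot all_order all_algebra.

Set Implicit Arguments.
Unset Strict Implicit.
Unset Printing Implicit Defensive.

Import GRing.Theory.

Local Open Scope ring_scope.

Definition period_doubling (n : nat) : nat := (logn 2 n.+1 %% 2)%N.

(* Sequences are identified up to pointwise equality. *)
Definition in_kernel (k : nat) (s t : nat -> int) : Prop :=
  exists i r : nat, (r < k ^ i)%N /\ forall n : nat, t n = s (k ^ i * n + r)%N.

Definition int_lin_comb (N : nat) (S : 'I_N -> nat -> int) (t : nat -> int)
    : Prop :=
  exists c : 'I_N -> int, forall n : nat, t n = \sum_(j < N) c j * S j n.

(* The finite set of sequences is given by a finite enumeration. *)
Definition k_regular (k : nat) (s : nat -> int) : Prop :=
  exists (N : nat) (S : 'I_N -> nat -> int),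
    forall t : nat -> int, in_kernel k s t -> int_lin_comb S t.

(* A set of natural numbers has at most one such enumeration o, and has one
   exactly when it is infinite. *)
Definition increasing_enumeration (P : nat -> Prop) (o : nat -> nat) : Prop :=
  (forall m n : nat, (m < n)%N -> (o m < o n)%N) /\
  (forall m : nat, (exists n : nat, o n = m) <-> P m).

(* Main.v *)
Require Import Defs.
From mathcomp Require Import all_boot all_order all_algebra.
From mathcomp Require Import cyclic zify.

(** Write [d] for the period-doubling sequence and [C x] for the number of
    [j < x] with [d j = 1], so that [o] inverts [C] on the ones of [d].

    Regularity collapses modulo a fixed [m]: the sequences of the kernel are
    integer combinations of [N] fixed sequences, and modulo [m] there are at
    most [m ^ N] such combinations. So for [q = k ^ i] large enough, two
    different residues [r < r' < q] satisfy [o (q n + r) = o (q n + r')] modulo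
    [m] for all [n] ([kernel_collision]).

    On the other hand, a single arithmetic progression of indices already sees
    all of [o]. If [2 ^ M] divides [x], then [d] looks the same just after [x]
    as just after [0], whence [o (C x + p) = x + o p] for all [p] small with
    respect to [M] ([enum_add]). Moreover [C x] takes every value modulo [q] as
    [x] runs through the multiples of [2 ^ M] ([ones_below_residues]): the
    values taken for every [M] are closed under addition, and they contain a
    residue [a] together with [2 a + 1], coming from [C (4 ^ s)] and
    [C (2 * 4 ^ s) = 2 C (4 ^ s) + 1]. Choosing [x] with [C x + p] in the class
    of [r] and cancelling [x], the collision becomes
    [o p = o (p + (r' - r))] modulo [m] for every [p] ([enum_progression]).

    Finally take [m = 5]. The gaps of [o] lie between 1 and 4, so they are
    determined by [o] modulo 5, and they are periodic. Then the set of ones of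
    [d] is stable under some translation by [T > 0], which a comparison of
    2-adic valuations forbids ([enum_not_periodic_mod5]). *)

Lemma logn_add_low p M x y : prime p -> p ^ M %| x -> 0 < y < p ^ M ->
  logn p (x + y) = logn p y.
Proof.
move=> p_pr dvd_x /andP[y_gt0 y_lt].
have lt_eM : logn p y < M.
  rewrite -(ltn_exp2l _ _ (prime_gt1 p_pr)); apply: leq_ltn_trans y_lt.
  by apply: dvdn_leq => //; rewrite pfactor_dvdnn.
have leE e : e <= M -> (e <= logn p (x + y)) = (e <= logn p y).
  move=> le_eM; rewrite -!pfactor_dvdn ?addn_gt0 ?y_gt0 ?orbT //.
  by rewrite dvdn_addr //; apply: dvdn_trans dvd_x; rewrite dvdn_exp2l.
by apply/eqP; rewrite eqn_leq leE ?(ltnW lt_eM) // leqnn andbT leqNgt leE // ltnn.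
Qed.

Lemma period_doublingE m : period_doubling m = odd (logn 2 m.+1).
Proof. exact: modn2. Qed.

Lemma period_doubling_add M x y : 2 ^ M %| x -> y.+1 < 2 ^ M ->
  period_doubling (x + y) = period_doubling y.
Proof.
by move=> dvd_x lt_y; rewrite /period_doubling -addnS (@logn_add_low 2 M).
Qed.

Definition ones_below (x : nat) : nat :=
  count (fun m => period_doubling m == 1) (iota 0 x).

Lemma ones_below_add M x y : 2 ^ M %| x -> y < 2 ^ M ->
  ones_below (x + y) = ones_below x + ones_below y.
Proof.
move=> dvd_x lt_y; rewrite /ones_below iotaD count_cat; congr addn.
rewrite add0n -[x in iota x]addn0 iotaDl count_map; apply: eq_in_count => m /=.
rewrite mem_iota /= add0n => lt_my; rewrite (@period_doubling_add M) //.
exact: leq_ltn_trans lt_y.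
Qed.

Lemma ones_belowS x : ones_below x.+1 = ones_below x + odd (logn 2 x.+1).
Proof.
have := iotaD 0 x 1; rewrite addn1 /ones_below => ->.
by rewrite count_cat /= period_doublingE addn0 eqb1.
Qed.

(** With [N = 4 ^ s], the first [N] letters of the period-doubling sequence and
    the next [N] ones differ only in the last letter, which is 0 in the first
    block and 1 in the second one. *)
Lemma ones_below_double s :
  ones_below (2 ^ (2 * s).+1) = (2 * ones_below (2 ^ (2 * s))).+1.
Proof.
set N := 2 ^ (2 * s).
have N_gt0 : 0 < N by rewrite expn_gt0.
have eN : N.-1.+1 = N by rewrite prednK.
have -> : 2 ^ (2 * s).+1 = (N + N.-1).+1.
  by rewrite -addnS eN expnS mul2n -addnn.
rewrite ones_belowS (@ones_below_add (2 * s)) ?dvdnn -/N ?eN //.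
have -> : ones_below N = ones_below N.-1.
  by rewrite -{1}eN ones_belowS eN /N pfactorK // oddM addn0.
have log2N : logn 2 (N + N) = (2 * s).+1.
  by rewrite addnn -mul2n /N -expnS pfactorK.
rewrite -addnS eN log2N /= oddM /=; lia.
Qed.

Lemma ones_below_pow4 s : 3 * ones_below (2 ^ (2 * s)) + 1 = 2 ^ (2 * s).
Proof.
elim: s => [|s IHs]; first by [].
have e2 : 2 * s.+1 = (2 * s).+2 by lia.
rewrite e2; set t := 2 * s in IHs *.
set N := 2 ^ t.+1.
have N_gt0 : 0 < N by rewrite expn_gt0.
have eN : N.-1.+1 = N by rewrite prednK.
have eNN : 2 ^ t.+2 = (N + N.-1).+1 by rewrite -addnS eN expnS mul2n -addnn.
have NE : N = 2 * 2 ^ t by rewrite /N expnS.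
have logN : logn 2 N = t.+1 by rewrite /N pfactorK.
have log2N : logn 2 (N + N) = t.+2 by rewrite addnn -mul2n /N -expnS pfactorK.
have odd_t : odd t = false by rewrite /t oddM.
have D := ones_below_double s; rewrite -/t -/N in D.
have S := ones_belowS N.-1; rewrite eN logN /= odd_t /= in S.
rewrite eNN ones_belowS (@ones_below_add t.+1) ?dvdnn -/N ?eN //.
rewrite -addnS eN log2N /= odd_t; lia.
Qed.

(** Modulo [n], the powers of 4 are eventually periodic: once the exponent
    absorbs the power of 2 in [n], Euler's theorem applies to the odd part. *)
Lemma pow4_recurrent n : 0 < n ->
  exists s, forall M, exists2 s', M <= s' & 2 ^ (2 * s') = 2 ^ (2 * s) %[mod n].
Proof.
move=> n_gt0; set c := n`_2^'; set l := logn 2 n.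
have nE : n = 2 ^ l * c by rewrite /l -p_part partnC.
have c_gt0 : 0 < c by rewrite part_gt0.
have co2c : coprime 2 c.
  by have := @coprime_partC 2 2 n; rewrite part_pnat_id.
exists l => M; exists (l + totient c * M).
  by rewrite (leq_trans _ (leq_addl _ _)) // leq_pmull // totient_gt0.
apply/eqP; rewrite eqn_mod_dvd ?leq_exp2l ?leq_mul2l ?leq_addr //.
rewrite mulnDr expnD -{2}[2 ^ (2 * l)]muln1 -mulnBr {1}nE dvdn_mul //.
  by rewrite dvdn_exp2l // leq_pmull.
rewrite -eqn_mod_dvd ?expn_gt0 // mulnCA expnM -modnXm.
by rewrite Euler_exp_totient // modnXm exp1n.
Qed.

(** The divisibility by an arbitrary power of 2 is what makes the set [H] of
    attained residues additive: a second summand [y] can be taken divisible by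
    a power of 2 larger than the first summand [x], and then
    [ones_below_add] applies. *)
Lemma ones_below_residues q r M : 0 < q ->
  exists2 x, 2 ^ M %| x & ones_below x = r %[mod q].
Proof.
move=> q_gt0.
pose H r := forall M, exists2 x, 2 ^ M %| x & ones_below x = r %[mod q].
have H0 : H 0 by move=> M'; exists 0; rewrite ?dvdn0.
have HD a b : H a -> H b -> H (a + b).
  move=> Ha Hb M'; have [x dvd_x Cx] := Ha M'.
  have [y dvd_y Cy] := Hb (M' + x); exists (y + x).
    by rewrite dvdn_add // (dvdn_trans _ dvd_y) // dvdn_exp2l // leq_addr.
  rewrite (@ones_below_add (M' + x)) //; last first.
    apply: leq_ltn_trans (ltn_expl _ (isT : 1 < 2)); exact: leq_addl.
  by rewrite addnC -modnDm Cx Cy modnDm.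
have HM a n : H a -> H (n * a).
  by move=> Ha; elim: n => [|n IHn]; rewrite ?mul0n // mulSn; apply: HD.
have Hmod a b : H a -> a = b %[mod q] -> H b.
  by move=> Ha ab M'; have [x dvd_x Cx] := Ha M'; exists x; rewrite ?Cx.
have q3_gt0 : 0 < 3 * q by rewrite muln_gt0.
(* The modulus 3 q lets the factor 3 of [ones_below_pow4] be cancelled. *)
have [s rec_s] := pow4_recurrent _ q3_gt0.
set a := ones_below (2 ^ (2 * s)).
have recC M' : exists2 s', M' <= s' & ones_below (2 ^ (2 * s')) = a %[mod q].
  have [s' le_s' eq_s'] := rec_s M'; exists s' => //.
  rewrite -(ones_below_pow4 s') -(ones_below_pow4 s) in eq_s'.
  apply/eqP; move/eqP: eq_s'.
  by rewrite eqn_modDr -!muln_modr eqn_pmul2l.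
have Ha : H a.
  move=> M'; have [s' le_s' Cs'] := recC M'; exists (2 ^ (2 * s')) => //.
  by rewrite dvdn_exp2l //; lia.
have Hb : H (2 * a).+1.
  move=> M'; have [s' le_s' Cs'] := recC M'; exists (2 ^ (2 * s').+1).
    by rewrite dvdn_exp2l //; lia.
  rewrite ones_below_double -addn1 -[in RHS]addn1.
  by rewrite -modnDml -modnMmr Cs' modnMmr modnDml.
have H1 : H 1.
  (* Modulo q, adding q - 1 copies of 2 a subtracts 2 a. *)
  apply: Hmod (HD _ _ Hb (HM _ (2 * q.-1) Ha)) _.
  have -> : (2 * a).+1 + 2 * q.-1 * a = (2 * a) * q + 1.
    by case: (q) q_gt0 => // q' _ /=; lia.
  by rewrite modnMDl.
by have := HM 1 r H1 M; rewrite muln1.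
Qed.

(** Since the coefficients are integers, they may be reduced modulo [m]: this
    leaves finitely many combinations of the generators, against [k ^ i]
    choices of [r]. *)
Lemma kernel_collision k s m : k_regular k s ->
  exists B, forall i, B < k ^ i ->
    exists r r', [/\ r < r', r' < k ^ i &
      forall n, ((s (k ^ i * n + r)%N)%:~R = (s (k ^ i * n + r')%N)%:~R :> 'Z_m)%R].
Proof.
move=> [N [S span_S]]; exists #|{ffun 'I_N -> 'Z_m}| => i ltB.
have comb (r : 'I_(k ^ i)) :
    exists c : 'I_N -> int,
      forall n, (s (k ^ i * n + r)%N = \sum_(j < N) c j * S j n)%R.
  by apply: span_S (fun n => s (k ^ i * n + r)) _; exists i, r.
have [c cE] := fin_all_exists comb.
pose cm (r : 'I_(k ^ i)) := [ffun j => ((c r j)%:~R : 'Z_m)%R].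
have /injectivePn[r [r' neq_rr' eq_c]] : ~~ injectiveb cm.
  apply/injectiveP => /leq_card; rewrite card_ord leqNgt ltB //.
have eq_s n : ((s (k ^ i * n + r)%N)%:~R = (s (k ^ i * n + r')%N)%:~R :> 'Z_m)%R.
  rewrite !cE !GRing.rmorph_sum; apply: eq_bigr => j _ /=; rewrite !intrM.
  by have /ffunP/(_ j) := eq_c; rewrite !ffunE => ->.
have [lt|gt|/val_inj eq] := ltngtP r r'.
- by exists r, r'; split.
- by exists r', r; split.
by rewrite eq eqxx in neq_rr'.
Qed.

(** With [v] the valuation of [T]: if [v] is odd, then [T + T] has the even
    valuation [v + 1]; if [v] is even, then adding [T] to a number of larger
    odd valuation gives valuation [v]. *)
Lemma period_doubling_not_shift_closed T : 0 < T ->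
  exists2 m, period_doubling m = 1 & period_doubling (m + T) <> 1.
Proof.
move=> T_gt0; case odd_v: (odd (logn 2 T)).
  exists T.-1; first by rewrite period_doublingE prednK // odd_v.
  rewrite period_doublingE -addSn prednK // addnn -mul2n lognM // lognE /=.
  by rewrite odd_v.
set X := 2 ^ (2 * T).+1; have eX : X.-1.+1 = X by rewrite prednK ?expn_gt0.
exists X.-1; first by rewrite period_doublingE eX pfactorK //= oddM.
rewrite period_doublingE -addSn eX (@logn_add_low 2 (2 * T).+1) ?odd_v //.
rewrite T_gt0 (leq_trans (ltn_expl T (isT : 1 < 2))) // leq_exp2l //; lia.
Qed.

(** An integer [m' + 1] congruent to 2 modulo 4 has valuation 1. *)
Lemma period_doubling_gap m :
  exists2 m', period_doubling m' = 1 & m < m' <= m + 4.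
Proof.
have log1 j : period_doubling (4 * j + 1) = 1.
  rewrite period_doublingE (_ : (4 * j + 1).+1 = 2 * (2 * j).+1); last by lia.
  rewrite lognM // (lognE 2 (2 * j).+1) lognE /=.
  by rewrite dvdn2 /= oddM.
exists (4 * (m.+3 %/ 4) + 1) => //; lia.
Qed.

Lemma ones_below_enum o n :
  increasing_enumeration (fun m => period_doubling m = 1) o ->
  ones_below (o n) = n.
Proof.
move=> [incr_o mem_o].
have mono : {mono o : m n / m <= n}.
  by apply: leq_mono => a b; apply: incr_o.
have inj_o : injective o by exact: incn_inj.
rewrite /ones_below -size_filter -[RHS](size_iota 0) -(size_map o (iota 0 n)).
apply: perm_size; apply: uniq_perm.
- by apply: filter_uniq; apply: iota_uniq.
- by rewrite map_inj_uniq ?iota_uniq.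
move=> m; rewrite mem_filter mem_iota add0n /=; apply/andP/mapP.
  case=> /eqP/mem_o[j <-] lt_j; exists j => //.
  by rewrite mem_iota /= add0n ltnNge -mono -ltnNge.
case=> j; rewrite mem_iota /= add0n => lt_jn ->; split; last exact: incr_o.
by apply/eqP/mem_o; exists j.
Qed.

Lemma enum_add o M x p :
  increasing_enumeration (fun m => period_doubling m = 1) o ->
  2 ^ M %| x -> (o p).+1 < 2 ^ M -> o (ones_below x + p) = x + o p.
Proof.
move=> ho dvd_x lt_p; have [_ mem_o] := ho.
have /mem_o[n on] : period_doubling (x + o p) = 1.
  by rewrite (@period_doubling_add M) //; apply/mem_o; exists p.
have := ones_below_enum _ n ho; rewrite on (@ones_below_add M) //; last exact: ltnW.
by rewrite ones_below_enum // => ->.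
Qed.

(** Any window of [o] is copied, up to an additive constant, at a place whose
    index has any prescribed residue modulo [q]; the constant cancels in the
    congruence. *)
Lemma enum_progression o q r r' m :
  increasing_enumeration (fun m => period_doubling m = 1) o ->
  r < r' < q ->
  (forall n, o (q * n + r) = o (q * n + r') %[mod m]) ->
  forall p, o p = o (p + (r' - r)) %[mod m].
Proof.
move=> ho /andP[lt_rr' lt_r'q] eq_o p; set t := r' - r.
(* The block of length 2 ^ M contains both o p and o (p + t). *)
set M := (o (p + t)).+1.
have lt_M j : j <= p + t -> (o j).+1 < 2 ^ M.
  move=> le_j; apply: leq_ltn_trans (ltn_expl M (isT : 1 < 2)).
  rewrite ltnS; move: le_j; rewrite leq_eqVlt => /predU1P[-> //|lt_j].
  by apply: ltnW; apply: (proj1 ho).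
have q_gt0 : 0 < q by lia.
(* The term q * p keeps the truncated subtraction of p exact. *)
have [x dvd_x Cx] := ones_below_residues q (r + q * p - p) M q_gt0.
have eq_pos : ones_below x + p = q * ((ones_below x + p) %/ q) + r.
  rewrite {1}(divn_eq (ones_below x + p) q) mulnC; congr addn.
  rewrite -modnDml Cx modnDml subnK; last first.
    by rewrite (leq_trans _ (leq_addl _ _)) // leq_pmull.
  by rewrite addnC mulnC modnMDl modn_small // (ltn_trans lt_rr').
have := eq_o ((ones_below x + p) %/ q).
rewrite (_ : r' = r + t) ?addnA -?eq_pos; last by rewrite /t subnKC // ltnW.
rewrite -addnA !(@enum_add o M) ?lt_M ?leq_addr //.
by move/eqP; rewrite eqn_modDl => /eqP.
Qed.

Lemma enum_not_periodic_mod5 o t :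
  increasing_enumeration (fun m => period_doubling m = 1) o -> 0 < t ->
  ~ (forall p, o p = o (p + t) %[mod 5]).
Proof.
move=> ho t_gt0 per; have [incr_o mem_o] := ho.
have gap n : o n < o n.+1 <= o n + 4.
  rewrite incr_o //=.
  have [m' /mem_o[n' <-] /andP[lt_n' le_n']] := period_doubling_gap (o n).
  apply: leq_trans le_n'.
  have mono : {mono o : m n / m <= n} by apply: leq_mono => a b; apply: incr_o.
  by rewrite mono ltnNge -mono -ltnNge.
have shift p : o (p + t) = o p + (o t - o 0).
  have lt_0t : o 0 < o t by apply: incr_o.
  elim: p => [|p IHp]; first by rewrite add0n; lia.
  have := per p; have := per p.+1; have := gap p; have := gap (p + t).
  rewrite addSn; lia.
have [|m dm []] := period_doubling_not_shift_closed (o t - o 0).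
  by rewrite subn_gt0 incr_o.
have [p <-] := (mem_o m).2 dm.
by apply/mem_o; exists (p + t); rewrite shift.
Qed.

Theorem proposition7 (o : nat -> nat)
  (ho : increasing_enumeration (fun m : nat => period_doubling m = 1%N) o)
  (k : nat) (hk : (2 <= k)%N) :
  ~ k_regular k (fun n : nat => Posz (o n)).
Proof.
move=> reg; have [B collide] := kernel_collision _ _ 5 reg.
have [r [r' [lt_rr' lt_r' eq_o]]] := collide B (ltn_expl B hk).
apply: (enum_not_periodic_mod5 o (r' - r) ho); first by rewrite subn_gt0.
apply: (enum_progression o (k ^ B)) => //; first by rewrite lt_rr'.
by move=> n; have /(congr1 val) := eq_o n; rewrite /= -!pmulrn !val_Zp_nat.
Qed.
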